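(* There is a matrix operator $T:\ell_\infty/c_0\rightarrow\ell_\infty/c_0$ which has fountains (that is, $T$ is not fountainless) and such that for every infinite $A\subseteq\mathbb{N}$ with $T\circ I_A\neq 0$, the operator $T\circ I_A$ is not canonizable along any continuous map. In particular $T$ is nowhere trivial.
   Context: Operators are bounded and linear. $[f]$ is the class of $f$ modulo null functions. $\mathbb{N}^*=\beta\mathbb{N}\setminus\mathbb{N}$; for $A\subseteq\mathbb{N}$, $A^*=\overline{A}^{\beta\mathbb{N}}\setminus A$ is the corresponding clopen subset of $\mathbb{N}^*$. $\ell_\infty/c_0$ is canonically identified with $C(\mathbb{N}^* )$ and $\ell_\infty(A)/c_0(A)$ with $C(A^* )$, the class $[f]$ corresponding to the restriction $f^*$ of the extension $\beta f$. The dual of $C(\mathbb{N}^* )$ is identified with the Radon measures on $\mathbb{N}^*$, and $T^\star$ is the adjoint. Matrix operator: there are cofinite $A,B\subseteq\mathbb{N}$ and a real matrix $(b_{ij})_{i\in B,j\in A}$ defining a bounded operator $c_0(A)\to c_0(B)$ such that $T([f])=[(\sum_{j\in A}b_{ij}f(j))_{i\in B}]$ for all $f\in\ell_\infty(A)$ (identifying $\ell_\infty(A)/c_0(A)$ and $\ell_\infty(B)/c_0(B)$ with $\ell_\infty/c_0$). $T$ is fountainless if for every nowhere dense $F\subseteq\mathbb{N}^*$ the set $\{y\in\mathbb{N}^*: T^\star(\delta_y)\text{ is nonzero and concentrated on }F\}$ is nowhere dense, where a measure $\mu$ is concentrated on $F$ if $|\mu|(\mathbb{N}^*\setminus F)=0$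 (it suffices to consider closed $F$). For infinite $A,B\subseteq\mathbb{N}$: $I_A([g])=[g\cup 0_{\mathbb{N}\setminus A}]$ for $g\in\ell_\infty(A)$, $P_B([f])=[f|B]$, $T_{B,A}=P_B\circ T\circ I_A$. The operator $T\circ I_A$ (viewed as an operator $C(A^* )\to C(\mathbb{N}^* )$) is canonizable along $\psi$ if $\psi:\mathbb{N}^*\rightarrow A^*$ is a continuous surjection and there is a nonzero real $r$ with $(T\circ I_A)(f^* )=r f^*\circ\psi$ for all $f^*\in C(A^* )$. $T$ is nowhere trivial if for no infinite $A,B\subseteq\mathbb{N}$ is $T_{B,A}$ trivial, where $T_{B,A}$ is trivial if there are sets $A'\subseteq A$ cofinite in $A$, $B'\subseteq B$ cofinite in $B$, a bijection $\sigma:B'\to A'$ and a nonzero real $r$ such that $T_{B,A}([f])=[rf\circ\sigma]$ for all $f\in\ell_\infty(A')$ (with the obvious identifications modulo finite sets). *)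

(* Defs.v *)
From HB Require Import structures.
From mathcomp Require Import all_boot all_order all_algebra.
From mathcomp Require Import all_classical all_reals all_analysis.

Set Implicit Arguments.
Unset Strict Implicit.
Unset Printing Implicit Defensive.

Import Order.TTheory GRing.Theory Num.Theory.
Import numFieldNormedType.Exports.

Local Open Scope classical_set_scope.
Local Open Scope quotient_scope.
Local Open Scope ring_scope.

(* The Banach spaces linf(I), c0(I) and linf(I)/c0(I), for a discrete index
   type I; a set A : set nat is used as an index type through the coercion
   set_type. *)

Section linf.
Context (R : realType) (I : Type).

Definition linf_pred : {pred I -> R} := mem [set f : I -> R | bounded_fun f].

Lemma linf_predP (f : I -> R) :
  reflect (exists M, forall i, `|f i| <= M) (f \in linf_pred).
Proof.
apply: (iffP idP); rewrite inE /=.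
  move=> /pinfty_ex_gt0[M _ fM]; exists M => i; exact: fM.
move=> [M fM]; exists M; split; first exact: num_real.
by move=> N MN i _; exact: (le_trans (fM i) (ltW MN)).
Qed.

Lemma linf_submod_closed : submod_closed linf_pred.
Proof.
split; first by apply/linf_predP; exists 0 => i; rewrite normr0.
move=> a f g /linf_predP[M fM] /linf_predP[N gN]; apply/linf_predP.
exists (`|a| * M + N) => i; apply: (le_trans (ler_normD _ _)).
by rewrite lerD// normrM ler_wpM2l.
Qed.

HB.instance Definition _ :=
  GRing.isSubmodClosed.Build R (I -> R) linf_pred linf_submod_closed.

Record linf := Linf { linf_val :> I -> R; linfP : linf_val \in linf_pred }.

HB.instance Definition _ := [isSub for linf_val].
HB.instance Definition _ := [Choice of linf by <:].
HB.instance Definition _ := [SubChoice_isSubLmodule of linf by <:].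

Definition linf_norm (f : linf) : R := sup (range (fun i => `|f i|)).

Lemma linf_ubound (f : linf) : has_ubound (range (fun i => `|f i|)).
Proof. by case/linf_predP: (linfP f) => M fM; exists M => _ [i _ <-]. Qed.

Lemma le_linf_norm (f : linf) i : `|f i| <= linf_norm f.
Proof. by apply: ub_le_sup; [exact: linf_ubound | exists i]. Qed.

Lemma linf_norm_le (f : linf) M :
  0 <= M -> (forall i, `|f i| <= M) -> linf_norm f <= M.
Proof.
move=> M0 fM; rewrite /linf_norm; set S := [set _ | _ in _].
have [[x Sx]|S0] := pselect (S !=set0).
  by apply: ge_sup; [exists x | move=> _ [i _ <-]].
by rewrite (_ : S = set0) ?sup0//; apply/eqP/negPn/negP => /set0P.
Qed.

Lemma linf_norm_ge0 (f : linf) : 0 <= linf_norm f.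
Proof.
rewrite /linf_norm; set S := [set _ | _ in _].
have [[_ [i _ _]]|S0] := pselect (S !=set0).
  exact: le_trans (le_linf_norm f i).
by rewrite (_ : S = set0) ?sup0//; apply/eqP/negPn/negP => /set0P.
Qed.

Lemma linf_normD (f g : linf) :
  linf_norm (f + g) <= linf_norm f + linf_norm g.
Proof.
apply: linf_norm_le => [|i]; first by rewrite addr_ge0 ?linf_norm_ge0.
by apply: (le_trans (ler_normD _ _)); rewrite lerD ?le_linf_norm.
Qed.

Lemma linf_normZ (a : R) (f : linf) :
  linf_norm (a *: f) = `|a| * linf_norm f.
Proof.
have le1 b (h : linf) : linf_norm (b *: h) <= `|b| * linf_norm h.
  apply: linf_norm_le => [|i]; first by rewrite mulr_ge0 ?linf_norm_ge0.
  by rewrite normrM ler_wpM2l ?le_linf_norm.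
apply/eqP; rewrite eq_le le1/=.
have [->|a0] := eqVneq a 0; first by rewrite normr0 mul0r linf_norm_ge0.
rewrite -{1}[f]scale1r -(mulVf a0) -scalerA.
by rewrite (le_trans (ler_wpM2l _ (le1 _ _)))// normfV mulrA mulfV ?mul1r ?normr_eq0.
Qed.

Lemma linf_norm0_eq0 (f : linf) : linf_norm f = 0 -> f = 0.
Proof.
move=> f0; apply/val_inj/funext => i /=; apply/eqP.
by rewrite -normr_le0 -f0 le_linf_norm.
Qed.

HB.instance Definition _ := @Lmodule_isNormed.Build R linf linf_norm
  linf_normD linf_normZ linf_norm0_eq0.

Definition c0 : {pred linf} :=
  mem [set f : linf | forall e, 0 < e -> finite_set [set i | e <= `|f i|]].

Lemma c0P (f : linf) :
  reflect (forall e, 0 < e -> finite_set [set i | e <= `|f i|]) (f \in c0).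
Proof. by apply: (iffP idP); rewrite inE. Qed.

Lemma c0_submod_closed : submod_closed c0.
Proof.
split.
  apply/c0P => e e0; rewrite (_ : mkset _ = set0) //.
  by apply/seteqP; split=> // i /=; rewrite normr0 leNgt e0.
move=> a f g /c0P f0 /c0P g0; apply/c0P => e e0.
pose b := `|a| + 1; have b0 : 0 < b by rewrite ltr_wpDl.
have e20 : 0 < e / 2 by rewrite divr_gt0.
have: finite_set ([set i | e / 2 / b <= `|f i|] `|` [set i | e / 2 <= `|g i|]).
  by rewrite finite_setU; split; [apply: f0; rewrite divr_gt0 | exact: g0].
apply: sub_finite_set => i /= le_e; apply/orP.
rewrite -implyNb -ltNge; apply/implyP => lt_f; rewrite leNgt; apply/negP => lt_g.
move: le_e; apply/negP; rewrite -ltNge (le_lt_trans (ler_normD _ _))//.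
rewrite [e]splitr (ler_ltD _ lt_g)// normrM.
rewrite ltr_pdivlMr// in lt_f; apply: le_trans (ltW lt_f).
by rewrite mulrC ler_wpM2l// lerDl.
Qed.

HB.instance Definition _ :=
  GRing.isSubmodClosed.Build R linf c0 c0_submod_closed.

Definition linf_c0 := Quotient.quot c0.

HB.instance Definition _ := GRing.Zmodule.on linf_c0.

Definition cls (f : linf) : linf_c0 := \pi_(Quotient.quot c0) f.

Lemma clsP (f g : linf) : cls f = cls g <-> f - g \in c0.
Proof.
by rewrite Quotient.idealrBE; split=> [/eqP|/eqP].
Qed.

Lemma cls_repr (q : linf_c0) : cls (repr q) = q.
Proof. exact: reprK. Qed.

Lemma clsD (f g : linf) : cls (f + g) = cls f + cls g.
Proof. exact: (raddfD (\pi_(Quotient.quot c0))). Qed.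

Lemma cls0 : cls 0 = 0.
Proof. exact: (raddf0 (\pi_(Quotient.quot c0))). Qed.

Definition linf_c0_scale (a : R) (q : linf_c0) : linf_c0 := cls (a *: repr q).

Lemma cls_scale a f : cls (a *: f) = linf_c0_scale a (cls f).
Proof.
apply/clsP; rewrite -scalerBr rpredZ//.
by apply/clsP; rewrite cls_repr.
Qed.

Lemma linf_c0_scaleA a b q :
  linf_c0_scale a (linf_c0_scale b q) = linf_c0_scale (a * b) q.
Proof. by rewrite -(cls_repr q) -!cls_scale scalerA. Qed.

Lemma linf_c0_scale1 : left_id 1 linf_c0_scale.
Proof. by move=> q; rewrite -(cls_repr q) -cls_scale scale1r. Qed.

Lemma linf_c0_scaleDr : right_distributive linf_c0_scale +%R.
Proof.
move=> a p q; rewrite -(cls_repr p) -(cls_repr q) -clsD -!cls_scale.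
by rewrite scalerDr clsD.
Qed.

Lemma linf_c0_scaleDl q :
  {morph linf_c0_scale^~ q : a b / a + b >-> a + b}.
Proof. by move=> a b; rewrite -(cls_repr q) -!cls_scale scalerDl clsD. Qed.

HB.instance Definition _ := GRing.Zmodule_isLmodule.Build R linf_c0
  linf_c0_scaleA linf_c0_scale1 linf_c0_scaleDr linf_c0_scaleDl.

Lemma clsZ a f : cls (a *: f) = a *: cls f.
Proof. exact: cls_scale. Qed.

Definition linf_c0_norm (q : linf_c0) : R :=
  inf [set `|f| | f in [set f : linf | cls f = q]].

Lemma linf_c0_norm_has_inf q :
  has_inf [set `|f| | f in [set f : linf | cls f = q]].
Proof.
split; first by exists `|repr q|, (repr q) => //; exact: cls_repr.
by exists 0 => _ [f _ <-].
Qed.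

Lemma linf_c0_norm_le (f : linf) : linf_c0_norm (cls f) <= `|f|.
Proof. by apply: ge_inf; [case: (linf_c0_norm_has_inf (cls f)) | exists f]. Qed.

Lemma linf_c0_norm_ge0 q : 0 <= linf_c0_norm q.
Proof.
by apply: lb_le_inf; [case: (linf_c0_norm_has_inf q) | move=> _ [f _ <-]].
Qed.

Lemma linf_c0_norm_adherent q e :
  0 < e -> exists2 f, cls f = q & `|f| < linf_c0_norm q + e.
Proof.
move=> e0; have [_ [f qf <-] lt_f] := inf_adherent e0 (linf_c0_norm_has_inf q).
by exists f.
Qed.

Lemma linf_c0_normD p q :
  linf_c0_norm (p + q) <= linf_c0_norm p + linf_c0_norm q.
Proof.
apply/ler_addgt0Pr => e e0; have e20 : 0 < e / 2 by rewrite divr_gt0.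
have [f fp lt_f] := linf_c0_norm_adherent p e20.
have [g gq lt_g] := linf_c0_norm_adherent q e20.
rewrite -{1}fp -{1}gq -clsD (le_trans (linf_c0_norm_le _))//.
rewrite (le_trans (ler_normD _ _))// [e]splitr addrACA.
by rewrite lerD// ltW.
Qed.

Lemma linf_c0_normZ a q : linf_c0_norm (a *: q) = `|a| * linf_c0_norm q.
Proof.
have norm0 : linf_c0_norm 0 = 0.
  apply/eqP; rewrite eq_le linf_c0_norm_ge0 andbT -cls0.
  by rewrite (le_trans (linf_c0_norm_le _))// normr0.
have [->|a0] := eqVneq a 0; first by rewrite scale0r normr0 mul0r.
have le1 b p : b != 0 -> linf_c0_norm (b *: p) <= `|b| * linf_c0_norm p.
  move=> b0; have nb0 : 0 < `|b| by rewrite normr_gt0.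
  rewrite mulrC -ler_pdivrMr//; apply: lb_le_inf.
    by case: (linf_c0_norm_has_inf p).
  move=> _ [f <- <-]; rewrite ler_pdivrMr// -clsZ mulrC -normrZ.
  exact: linf_c0_norm_le.
apply/eqP; rewrite eq_le le1//=.
rewrite -{1}[q]scale1r -(mulVf a0) -scalerA.
rewrite (le_trans (ler_wpM2l _ (le1 _ _ _)))// ?invr_eq0//.
by rewrite normfV mulrA mulfV ?mul1r ?normr_eq0.
Qed.

Lemma linf_c0_norm0_eq0 q : linf_c0_norm q = 0 -> q = 0.
Proof.
move=> q0; rewrite -(cls_repr q) -cls0; apply/clsP; rewrite subr0.
apply/c0P => e e0; have e20 : 0 < e / 2 by rewrite divr_gt0.
have [h hq] := linf_c0_norm_adherent q e20; rewrite q0 add0r => lt_h.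
have: repr q - h \in c0 by apply/clsP; rewrite cls_repr.
move=> /c0P/(_ _ e20); apply: sub_finite_set => i /= le_e.
rewrite leNgt; apply/negP => lt_d; move: le_e; apply/negP; rewrite -ltNge.
have -> : repr q i = (repr q - h) i + h i by rewrite /= subrK.
rewrite [e]splitr (le_lt_trans (ler_normD _ _))// ltrD//.
exact: le_lt_trans (le_linf_norm h i) lt_h.
Qed.

HB.instance Definition _ := @Lmodule_isNormed.Build R linf_c0 linf_c0_norm
  linf_c0_normD linf_c0_normZ linf_c0_norm0_eq0.

End linf.

Arguments linf_pred R I : clear implicits.
Arguments c0 {R I}.
Arguments cls {R I}.

Section change_index.
Context (R : realType) (J I : Type) (e : J -> I).

Definition ext0_fun (f : J -> R) (i : I) : R :=
  if pselect (exists j, e j = i) is left ex then f (sval (cid ex)) else 0.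

Lemma ext0_subproof (f : linf R J) : ext0_fun f \in linf_pred R I.
Proof.
apply/linf_predP; exists `|f| => i; rewrite /ext0_fun.
by case: pselect => [ex|_]; [exact: le_linf_norm | rewrite normr0].
Qed.

(* f \cup 0, for e the inclusion of J in I *)
Definition ext0 (f : linf R J) : linf R I := Linf (ext0_subproof f).

Lemma res_subproof (f : linf R I) : f \o e \in linf_pred R J.
Proof. by apply/linf_predP; exists `|f| => j; exact: le_linf_norm. Qed.

Definition res (f : linf R I) : linf R J := Linf (res_subproof f).

Definition ext0q (q : linf_c0 R J) : linf_c0 R I := cls (ext0 (repr q)).

Definition resq (q : linf_c0 R I) : linf_c0 R J := cls (res (repr q)).

Lemma ext0E f j : injective e -> ext0 f (e j) = f j.
Proof.
move=> inj_e; rewrite /= /ext0_fun; case: pselect => [ex|[]]; last by exists j.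
by congr (f _); apply: inj_e; exact: (svalP (cid ex)).
Qed.

Lemma ext0_out f i : ~ (exists j, e j = i) -> ext0 f i = 0.
Proof. by move=> nex; rewrite /= /ext0_fun; case: pselect. Qed.

Lemma ext0q_cls f : ext0q (cls f) = cls (ext0 f).
Proof.
apply/clsP/c0P => r r0.
have /clsP/c0P/(_ _ r0) fin := cls_repr (cls f).
move: (finite_image e fin); apply: sub_finite_set => i /=.
have [ex|nex] := pselect (exists j, e j = i); last first.
  have extE (h : J -> R) : ext0_fun h i = 0.
    by rewrite /ext0_fun; case: pselect.
  by rewrite !fctE !extE subr0 normr0 leNgt r0.
have extE (h : J -> R) : ext0_fun h i = h (sval (cid ex)).
  rewrite /ext0_fun; case: pselect => // ex'.
  by rewrite (Prop_irrelevance ex' ex).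
rewrite !fctE !extE => le_r; exists (sval (cid ex)) => //; exact: (svalP (cid ex)).
Qed.

Lemma resq_cls f : injective e -> resq (cls f) = cls (res f).
Proof.
move=> inj_e; apply/clsP/c0P => r r0.
have /clsP/c0P/(_ _ r0) fin := cls_repr (cls f).
by apply: (finite_preimage (f := e) _ fin) => x y _ _; exact: inj_e.
Qed.

End change_index.

Section index_sets.
Context (R : realType).

Definition I_ (A : set nat) : linf_c0 R A -> linf_c0 R nat :=
  ext0q (set_val : A -> nat).

Definition P_ (B : set nat) : linf_c0 R nat -> linf_c0 R B :=
  resq (set_val : B -> nat).

(* The identification of linf(A')/c0(A') with linf(A)/c0(A), for A' cofinite
   in A. *)
Definition iota_ (A' A : set nat) (sA : A' `<=` A) :
    linf_c0 R A' -> linf_c0 R A :=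
  ext0q (subfun sA).

End index_sets.

Arguments I_ {R} A q.
Arguments P_ {R} B q.

(* beta N is the space of ultrafilters on nat, n : nat being identified with
   the principal ultrafilter at n. *)

Record betaN := BetaN {
  ultra :> set_system nat;
  ultraP : UltraFilter ultra }.

Existing Instance ultraP.

Lemma betaN_eq (p q : betaN) : ultra p = ultra q -> p = q.
Proof.
case: p q => p pU [q qU] /= pq; rewrite -pq in qU *.
by congr BetaN; exact: Prop_irrelevance.
Qed.

HB.instance Definition _ := gen_eqMixin betaN.
HB.instance Definition _ := gen_choiceMixin betaN.

Lemma betaN_cover :
  \bigcup_(A in [set: set nat]) [set p : betaN | ultra p A] = setT.
Proof. by apply/seteqP; split => // p _; exists setT => //; exact: filterT. Qed.

Lemma betaN_join (A B : set nat) (p : betaN) : setT A -> setT B ->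
  ultra p A -> ultra p B ->
  exists C : set nat, [/\ setT C, ultra p C &
    [set q : betaN | ultra q C] `<=`
    [set q : betaN | ultra q A] `&` [set q : betaN | ultra q B]].
Proof.
move=> _ _ pA pB; exists (A `&` B); split => //; first exact: filterI.
by move=> q qAB; split; apply: filterS qAB => n [].
Qed.

HB.instance Definition _ :=
  isBaseTopological.Build betaN betaN_cover betaN_join.

Definition principal (n : nat) : betaN := BetaN (principal_filter_ultra n).

Definition Nstar : Type := set_type (~` range principal).

HB.instance Definition _ := Topological.on Nstar.

Definition Nstar_val (y : Nstar) : betaN := val y.

Definition Astar (A : set nat) : set Nstar :=
  [set y | (closure (principal @` A) `\` principal @` A) (Nstar_val y)].

Lemma open_betaN (A : set nat) : open [set p : betaN | ultra p A].
Proof. by exists [set A]; rewrite ?bigcup_set1. Qed.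

Lemma nbhs_betaN (p : betaN) (U : set betaN) :
  nbhs p U <-> exists2 A, ultra p A & [set q : betaN | ultra q A] `<=` U.
Proof.
rewrite nbhsE; split=> [[B [[D' _ <-] [A D'A pA]] sBU]|[A pA sAU]].
  by exists A => // q qA; apply: sBU; exists A.
by exists [set q : betaN | ultra q A] => //; split => //; exact: open_betaN.
Qed.

Lemma ultra_setC (p : betaN) (A : set nat) : ultra p (~` A) <-> ~ ultra p A.
Proof.
split=> [pCA pA|npA].
  by have /filter_ex[n []] : ultra p (A `&` ~` A) by exact: filterI.
by have [] := in_ultra_setVsetC A (ultraP p).
Qed.

Lemma closure_principal (A : set nat) :
  closure (principal @` A) = [set p : betaN | ultra p A].
Proof.
apply/seteqP; split=> p /=.
  move=> clp; apply: contrapT => /ultra_setC pCA.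
  have /clp[_ [[n An <-] /= /principal_filterP]] :
    nbhs p [set q : betaN | ultra q (~` A)] by apply/nbhs_betaN; exists (~` A).
  exact.
move=> pA U /nbhs_betaN[B pB sBU].
have /filter_ex[n [An Bn]] : ultra p (A `&` B) by exact: filterI.
exists (principal n); split; first by exists n.
by apply: sBU; exact/principal_filterP.
Qed.

Lemma AstarE (A : set nat) : Astar A = [set y | ultra (Nstar_val y) A].
Proof.
apply/seteqP; split=> y; rewrite /Astar closure_principal /=; first by case.
move=> yA; split => // -[n _ ny].
by have := set_mem (valP y); apply; exists n.
Qed.

Lemma Nstar_free (y : Nstar) (n : nat) : ~ ultra (Nstar_val y) [set n].
Proof.
move=> yn; have := set_mem (valP y); apply; exists n => //=.
apply/esym/betaN_eq/(@max_filter _ _ (principal_filter_ultra n)) => A.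
by move=> /principal_filterP An; apply: filterS yn => _ ->.
Qed.

Lemma Nstar_finite (y : Nstar) (A : set nat) :
  finite_set A -> ~ ultra (Nstar_val y) A.
Proof.
move=> /finite_seqP[s ->]; elim: s => [|n s IHs] ys.
  by have /filter_ex[n] := ys.
apply: IHs; have yn : ultra (Nstar_val y) (~` [set n]).
  by apply/ultra_setC; exact: Nstar_free.
by apply: filterS (filterI ys yn) => m /= [/predU1P[->|]].
Qed.

Lemma Nstar_inhabited : exists p : betaN, (~` range principal) p.
Proof.
have [F [FU sF]] := ultraFilterLemma (F := \oo) _.
exists (BetaN FU) => -[n _ /(congr1 ultra)/= En].
have : F [set m | (n < m)%N] by apply: sF; exists n.+1.
by rewrite -En => /principal_filterP /=; rewrite ltnn.
Qed.

HB.instance Definition _ := isPointed.Build Nstar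
  (exist _ (sval (cid Nstar_inhabited))
     (mem_set (svalP (cid Nstar_inhabited)))).

Section extension.
Context (R : realType).

(* beta f *)
Definition beta_ext (f : nat -> R) (p : betaN) : R := lim (f @ ultra p).

Lemma beta_ext_cvg (f : linf R nat) (p : betaN) :
  f @ ultra p --> beta_ext f p.
Proof.
suff [l fl] : exists l : R, f @ ultra p --> l.
  by have /cvg_ex := ex_intro (fun l => f @ ultra p --> l) l fl.
have fM : (f @ ultra p) `[- `|f|, `|f|]%classic.
  by apply: nearW => n /=; rewrite in_itv /= -ler_norml; exact: le_linf_norm.
have [l [_ fl]] := @segment_compact _ (- `|f|) `|f| (f @ ultra p) _ fM.
exists l => V lV; apply: contrapT => nV.
have /fl/(_ lV)[x []] : (f @ ultra p) (~` V) by exact/ultra_setC.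
by [].
Qed.

Lemma beta_ext_principal (f : linf R nat) n : beta_ext f (principal n) = f n.
Proof.
have fn : f @ ultra (principal n) --> f n.
  by move=> V fV; apply/principal_filterP; exact: nbhs_singleton fV.
exact: (cvg_unique _ (@beta_ext_cvg f (principal n)) fn).
Qed.

Lemma beta_ext_continuous (f : linf R nat) : continuous (beta_ext f).
Proof.
move=> p; apply/(@cvgrPdist_le _ _ _ (nbhs p) (nbhs_filter p)) => e e0.
have /cvgrPdist_le/(_ _ e0) pe := @beta_ext_cvg f p.
apply/nbhs_betaN; exists [set n | `|beta_ext f p - f n| <= e] => // q qe /=.
have dq : (fun n => `|beta_ext f p - f n|) @ ultra q -->
    `|beta_ext f p - beta_ext f q|.
  by apply: cvg_norm; apply: cvgB; [exact: cvg_cst | exact: beta_ext_cvg].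
exact: (closed_cvg (fun x : R => is_true (x <= e)) (@closed_le R e) qe _ dq).
Qed.

(* The identification of linf/c0 with C(N^* ): [f]^* is the restriction of
   beta f to N^*. *)
Definition star (q : linf_c0 R nat) : Nstar -> R :=
  fun y => beta_ext (repr q) (Nstar_val y).

Lemma star_cls (f : linf R nat) y : star (cls f) y = beta_ext f (Nstar_val y).
Proof.
have /clsP/c0P c := cls_repr (cls f).
apply/eqP; rewrite -subr_eq0; apply/eqP.
have dq : (fun n => repr (cls f) n - f n) @ ultra (Nstar_val y) -->
    star (cls f) y - beta_ext f (Nstar_val y).
  by apply: cvgB; exact: beta_ext_cvg.
suff d0 : (fun n => repr (cls f) n - f n) @ ultra (Nstar_val y) --> (0 : R).
  exact: (cvg_unique _ dq d0).
apply/cvgr0Pnorm_lt => e e0; apply: contrapT => /ultra_setC yC.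
have fin := c _ e0; apply: (@Nstar_finite y _ fin).
by apply: filterS yC => n /= /negP; rewrite -leNgt.
Qed.

Lemma star_continuous (q : linf_c0 R nat) : continuous (star q).
Proof.
move=> y; apply: (@continuous_comp _ _ _ Nstar_val (beta_ext (repr q))).
  exact: (@initial_continuous Nstar betaN Nstar_val).
exact: beta_ext_continuous.
Qed.

(* [g]^* : A^* -> R, for g in linf(A); on A^* it does not depend on the values
   outside A of the extension of g that is used. *)
Definition starA (A : set nat) (q : linf_c0 R A) : Astar A -> R :=
  fun y => star (I_ A q) (set_val y).

End extension.

Section radon.
Context (R : realType).

Definition nowhere_dense (X : topologicalType) (F : set X) :=
  interior (closure F) = set0.

Definition borelNstar := g_sigma_algebraType (@open Nstar).

Implicit Types (mu : {charge set borelNstar -> \bar R}) (F : set Nstar).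

Definition hahn_pos mu : set borelNstar :=
  sval (cid (Hahn_decomposition mu)).

Definition hahn_neg mu : set borelNstar :=
  sval (cid (svalP (cid (Hahn_decomposition mu)))).

Definition hahnP mu : hahn_decomposition mu (hahn_pos mu) (hahn_neg mu) :=
  svalP (cid (svalP (cid (Hahn_decomposition mu)))).

Definition charge_integral mu (g : borelNstar -> R) : R :=
  \int[jordan_pos (hahnP mu)]_x g x - \int[jordan_neg (hahnP mu)]_x g x.

Definition radon mu :=
  forall E : set borelNstar, measurable E ->
    charge_variation (hahnP mu) E =
    ereal_sup [set charge_variation (hahnP mu) K |
      K in [set K : set Nstar | compact K /\ K `<=` E]].

Definition nonzero_charge mu := exists2 E, measurable E & mu E <> 0%E.

(* |mu|(N^* \ F) = 0; F need not be Borel *)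
Definition concentrated_on mu F :=
  (charge_variation (hahnP mu)).-negligible (~` F).

(* mu is the Radon measure identified with the functional phi *)
Definition represents mu (phi : linf_c0 R nat -> R) :=
  radon mu /\ forall q, phi q = charge_integral mu (star q).

End radon.

Section operators.
Context (R : realType).

Local Notation linf_c0N := (linf_c0 R nat).

Implicit Types (T : linf_c0N -> linf_c0N) (A B : set nat).

Definition bounded_operator T := exists M, forall q, `|T q| <= M * `|q|.

Definition cofinite_in A' A := A' `<=` A /\ finite_set (A `\` A').

Definition cofinite A := cofinite_in A setT.

(* g(i) = \sum_(j in A) b_ij f(j) for all i in B, the sum being taken in the
   increasing order of A *)
Definition matrix_sends A B (b : B -> A -> R) (f : linf R A) (g : linf R B) :=
  forall i : B,
    series (ext0_fun (set_val : A -> nat) (fun j => b i j * f j)) @ \oo --> g i.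

Definition c0_matrix A B (b : B -> A -> R) :=
  exists M, forall f : linf R A, f \in c0 ->
    exists g : linf R B, [/\ g \in c0, matrix_sends b f g & `|g| <= M * `|f|].

Definition matrix_operator T :=
  exists A B (b : B -> A -> R), [/\ cofinite A, cofinite B, c0_matrix b &
    forall f : linf R A, exists2 g : linf R B,
      matrix_sends b f g & P_ B (T (I_ A (cls f))) = cls g].

Definition delta (y : Nstar) : linf_c0N -> R := fun q => star q y.

Definition adjoint T (phi : linf_c0N -> R) : linf_c0N -> R := phi \o T.

Definition fountainless T :=
  forall F : set Nstar, nowhere_dense F ->
    nowhere_dense [set y : Nstar | exists mu, [/\
      represents mu (adjoint T (delta y)),
      nonzero_charge mu & concentrated_on mu F]].

Definition canonizable_along A (TI : linf_c0 R A -> linf_c0N)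
    (psi : Nstar -> Astar A) :=
  [/\ continuous psi, range psi = setT &
    exists2 r : R, r != 0 &
      forall (q : linf_c0 R A) y, star (TI q) y = r * starA q (psi y)].

Definition T_BA T B A : linf_c0 R A -> linf_c0 R B :=
  P_ B \o T \o I_ A.

Arguments T_BA T B A q : clear implicits.

Definition trivial_operator B A (S : linf_c0 R A -> linf_c0 R B) :=
  exists (A' B' : set nat) (cA : cofinite_in A' A) (cB : cofinite_in B' B)
      (sigma : B' -> A') (r : R),
    [/\ bijective sigma, r != 0 &
      forall f : linf R A',
        S (iota_ cA.1 (cls f)) = iota_ cB.1 (cls (r *: res sigma f))].

Definition nowhere_trivial T :=
  forall A B, infinite_set A -> infinite_set B -> ~ trivial_operator (T_BA T B A).

End operators.

(* Main.v *)
Require Import Defs.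
From HB Require Import structures.
From mathcomp Require Import all_boot all_order all_algebra.
From mathcomp Require Import all_classical all_reals all_analysis.
From mathcomp Require Import ring lra.
Import Order.TTheory GRing.Theory Num.Theory numFieldNormedType.Exports.
Local Open Scope classical_set_scope.
Local Open Scope ring_scope.
Set Implicit Arguments.
Unset Strict Implicit.
Unset Printing Implicit Defensive.

(** The witness sends the class of [f] to the class of its averages over the
    dyadic blocks [2^i, 2^(i+1)). Its matrix has rows of norm one and tends to
    zero along columns, so it acts on the quotient.

    Call a set sparse when its proportion in the i-th block tends to zero.
    The operator kills the indicator of every sparse set, and every infinite
    set [A] contains an infinite sparse set [C] (one point per block that [A]
    meets, [infinite_sparse_subset]). This excludes canonizability and
    triviality at once: an operator of the form [r f \o psi] with [psi] onto
    [A^*], or of the form [r f \o sigma] with [sigma] a bijection, cannot kill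
    the indicator of [C] unless [r = 0]
    ([avgq_not_canonizable], [avgq_nowhere_trivial]).

    For the fountain, let [U] be the union of all [C^*] with [C] sparse. It is
    open, and dense because every infinite set contains an infinite sparse
    one; hence its complement [F] is nowhere dense. For every [y], the adjoint
    sends the Dirac measure at [y] to a probability measure that gives to
    [A^*] the limit along [y] of the proportions of [A] in the blocks. This
    measure vanishes on [C^*] for [C] sparse, hence on every compact subset
    of [U], because sparse sets form an ideal; as it is Radon it vanishes on
    [U]. So all of these measures are nonzero and concentrated on [F]
    ([avgq_fountain]).

    The measure itself comes from a Riesz representation theorem for positive
    functionals ([riesz_Nstar]). The values of the functional on indicators
    form a finitely additive content on the clopen subsets of the compact
    space [N^*]; such a content extends to a Radon measure
    ([radon_extension]); the functional and the integral are bounded and agree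
    on indicators, hence agree everywhere ([scalar_eq0]). *)

(** * Radon extension of a content on the clopen sets *)

Lemma clopenU (T : topologicalType) (A B : set T) :
  clopen A -> clopen B -> clopen (A `|` B).
Proof. by move=> [oA cA] [oB cB]; split; [exact: openU | exact: closedU]. Qed.

Lemma clopenI (T : topologicalType) (A B : set T) :
  clopen A -> clopen B -> clopen (A `&` B).
Proof. by move=> [oA cA] [oB cB]; split; [exact: openI | exact: closedI]. Qed.

Lemma clopenD (T : topologicalType) (A B : set T) :
  clopen A -> clopen B -> clopen (A `\` B).
Proof. by rewrite setDE => cA cB; apply: clopenI => //; exact: clopenC. Qed.

Lemma clopen_bigsetU (T : topologicalType) (I : Type) (s : seq I) (P : pred I)
    (K : I -> set T) :
  (forall i, clopen (K i)) -> clopen (\big[setU/set0]_(i <- s | P i) K i).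
Proof.
move=> cK; elim/big_ind : _ => //; last exact: clopenU.
by split; [exact: open0 | exact: closed0].
Qed.

Section clopen_content.
Context (R : realType) (X : ptopologicalType).
Context (compactX : compact [set: X]).
Context (clopen_base : forall (x : X) U, nbhs x U ->
  exists K, [/\ clopen K, K x & K `<=` U]).
Context (c : set X -> R).
Context (content_ge0 : forall K, clopen K -> 0 <= c K).
Context (contentU : forall K L, clopen K -> clopen L -> K `&` L = set0 ->
  c (K `|` L) = c K + c L).

Let clopen0 : clopen (set0 : set X).
Proof. by split; [exact: open0 | exact: closed0]. Qed.

Let clopenT : clopen [set: X].
Proof. by split; [exact: openT | exact: closedT]. Qed.

Let content0 : c set0 = 0.
Proof.
have /eqP := contentU clopen0 clopen0 (setI0 _).
by rewrite setU0 eq_sym -subr_eq0 addrK => /eqP.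
Qed.

Let contentD K L : clopen K -> clopen L -> c (K `|` L) = c K + c (L `\` K).
Proof.
move=> cK cL; rewrite -contentU ?setDIK//; last exact: clopenD.
by congr c; apply/seteqP; split=> x /=; have [|] := pselect (K x); tauto.
Qed.

Let le_content K L : clopen K -> clopen L -> K `<=` L -> c K <= c L.
Proof.
move=> cK cL /setUidPr KL; rewrite -KL contentD// lerDl.
by apply: content_ge0; exact: clopenD.
Qed.

Let contentU_le K L : clopen K -> clopen L -> c (K `|` L) <= c K + c L.
Proof.
move=> cK cL; rewrite contentD// lerD2l le_content//.
exact: clopenD.
Qed.

Let content_bigsetU_le (K : nat -> set X) n : (forall i, clopen (K i)) ->
  c (\big[setU/set0]_(i < n) K i) <= \sum_(i < n) c (K i).
Proof.
move=> cK; elim: n => [|n IHn]; first by rewrite !big_ord0 content0.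
rewrite !big_ord_recr/= (le_trans (contentU_le _ _))//; last by rewrite lerD2r.
exact: clopen_bigsetU.
Qed.

Local Open Scope ereal_scope.

Let contents U := [set (c K)%:E | K in [set K | clopen K /\ K `<=` U]].

Definition inner_content (U : set X) : \bar R := ereal_sup (contents U).

(** The infimum is over single open sets, not over countable clopen covers: an
    open set need not be a countable union of clopen sets, and every open set
    has to be measurable with a value given by the clopen sets inside it. *)
Definition content_outer (E : set X) : \bar R :=
  ereal_inf [set inner_content U | U in [set U | open U /\ E `<=` U]].

Let inner_content_ge0 U : 0 <= inner_content U.
Proof. by apply: ereal_sup_ubound; exists set0; [split | rewrite content0]. Qed.

Let le_inner_content U V : U `<=` V -> inner_content U <= inner_content V.
Proof.
move=> UV; apply: le_ereal_sup => _ [K [cK KU] <-]; exists K => //.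
by split=> //; exact: subset_trans KU UV.
Qed.

Let inner_content_fin U : inner_content U \is a fin_num.
Proof.
rewrite ge0_fin_numE//; apply: le_lt_trans (ltry (c setT)).
by apply: ge_ereal_sup => _ [K [cK _] <-]; rewrite lee_fin le_content.
Qed.

Let content_outer_ge0 E : 0 <= content_outer E.
Proof. by apply: le_ereal_inf_tmp => _ [U _ <-]. Qed.

Let content_outer_open U : open U -> content_outer U = inner_content U.
Proof.
move=> oU; apply/eqP; rewrite eq_le; apply/andP; split.
  by apply: ereal_inf_lbound; exists U; split.
by apply: le_ereal_inf_tmp => _ [V [_ UV] <-]; exact: le_inner_content.
Qed.

Let le_content_outer E F : E `<=` F -> content_outer E <= content_outer F.
Proof.
move=> EF; apply: le_ereal_inf => _ [U [oU FU] <-]; exists U => //.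
by split => //; exact: subset_trans EF FU.
Qed.

Let content_outer_fin E : content_outer E \is a fin_num.
Proof.
rewrite ge0_fin_numE//; apply: le_lt_trans (le_content_outer (@subsetT _ E)) _.
by rewrite content_outer_open ?ltey_eq ?inner_content_fin//; exact: openT.
Qed.

Let content_outer0 : content_outer set0 = 0.
Proof.
rewrite content_outer_open; last exact: open0.
apply/eqP; rewrite eq_le inner_content_ge0 andbT.
apply: ge_ereal_sup => _ [K [_ K0] <-].
by rewrite (_ : K = set0) ?content0//; rewrite -subset0.
Qed.

Let content_outer_adherent E (e : R) : (0 < e)%R ->
  exists U, [/\ open U, E `<=` U & inner_content U <= content_outer E + e%:E].
Proof.
move=> e0; have [_ [U [oU EU] <-] lt_U] :=
  lb_ereal_inf_adherent e0 (content_outer_fin E).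
by exists U; split=> //; exact: ltW.
Qed.

Let inner_content_adherent U (e : R) : (0 < e)%R ->
  exists K, [/\ clopen K, K `<=` U & inner_content U <= (c K)%:E + e%:E].
Proof.
move=> e0; have [_ [K [cK KU] <-] lt_K] :=
  ub_ereal_sup_adherent e0 (inner_content_fin U).
by exists K; split=> //; rewrite -leeBlDr// ltW.
Qed.

(** Compactness turns a countable open cover of a clopen set into a finite
    clopen cover subordinate to it: this is where countable subadditivity
    comes from. *)
Let clopen_subcover K (U : nat -> set X) : clopen K ->
  (forall n, open (U n)) -> K `<=` \bigcup_n U n ->
  exists (L : nat -> set X) N, [/\ forall n, clopen (L n),
    forall n, L n `<=` U n & K `<=` \big[setU/set0]_(n < N) L n].
Proof.
move=> [_ clK] oU KU.
have cptK : compact K by exact: subclosed_compact clK compactX _.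
have /choice[f fP] : forall x, exists p : set X * nat,
    K x -> [/\ clopen p.1, p.1 x & p.1 `<=` U p.2].
  move=> x; have [/KU[n _ Unx]|nKx] := pselect (K x); last by exists (set0, 0%N).
  have [V [cV Vx VU]] := clopen_base (open_nbhs_nbhs (conj (oU n) Unx)).
  by exists (V, n).
move: cptK; rewrite compact_cover => /(_ X K (fun x => (f x).1)).
case=> [x /fP[[]]//|x Kx|D DK KD]; first by exists x => //; case: (fP _ Kx).
pose L n := \big[setU/set0]_(x <- finmap.enum_fset D |
  (x \in K) && ((f x).2 == n)) (f x).1.
exists L, (\max_(x <- finmap.enum_fset D) (f x).2).+1; split=> [n|n x|x Kx].
- rewrite /L big_mkcond; apply: clopen_bigsetU => x.
  by case: ifP => // /andP[/set_mem/fP[]].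
- rewrite /L -bigcup_seq_cond => -[y /= /andP[_ /andP[/set_mem Ky /eqP <-]]].
  by case: (fP _ Ky) => _ _; exact.
- have [y /= yD fyx] := KD _ Kx; rewrite -bigcup_mkord.
  exists (f y).2.
    rewrite /= ltnS.
    exact: (@leq_bigmax_seq _ (finmap.enum_fset D) xpredT (fun x => (f x).2)).
  by rewrite /L -bigcup_seq_cond; exists y => //=; rewrite yD eqxx andbT; exact: DK.
Qed.

Let inner_content_bigcup (U : nat -> set X) : (forall n, open (U n)) ->
  inner_content (\bigcup_n U n) <= \sum_(n <oo) inner_content (U n).
Proof.
move=> oU; apply: ge_ereal_sup => _ [K [cK KU] <-].
have [L [N [cL LU KL]]] := clopen_subcover cK oU KU.
have le_cK : (c K <= \sum_(i < N) c (L i))%R.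
  by rewrite (le_trans _ (content_bigsetU_le _ _))// le_content//; exact: clopen_bigsetU.
apply: (@le_trans _ _ (\sum_(0 <= i < N) inner_content (U i))).
  rewrite big_mkord (@le_trans _ _ (\sum_(i < N) c (L i))%:E) ?lee_fin//.
  rewrite -sumEFin; apply: lee_sum => i _; apply: ereal_sup_ubound.
  by exists (L i).
by apply: nneseries_lim_ge.
Qed.

Let content_outer_sigma_subadditive : sigma_subadditive content_outer.
Proof.
move=> F; apply/lee_addgt0Pr => e e0.
have e2 n : (0 < e / (2 ^ n.+1)%:R)%R by rewrite divr_gt0// ltr0n expn_gt0.
have /choice[U UP] : forall n, exists U, [/\ open U, F n `<=` U &
    inner_content U <= content_outer (F n) + (e / (2 ^ n.+1)%:R)%:E].
  by move=> n; exact: content_outer_adherent.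
apply: le_trans (epsilon_trick _ _ (ltW e0)) => //.
apply: (@le_trans _ _ (content_outer (\bigcup_n U n))).
  by apply: le_content_outer; apply: subset_bigcup => n _; case: (UP n).
rewrite content_outer_open; last by apply: bigcup_open => n _; case: (UP n).
apply: (le_trans (inner_content_bigcup _)); first by move=> n; case: (UP n).
by apply: lee_nneseries => // n _; case: (UP n).
Qed.

HB.instance Definition _ := isOuterMeasure.Build R X content_outer
  content_outer0 content_outer_ge0 le_content_outer
  content_outer_sigma_subadditive.

(** Up to a small error, split an open [V] containing [E] into a clopen piece
    [K] of [V `&` U] and a clopen piece [L] of the rest of [V]; as [K] and [L]
    are disjoint subsets of [V], additivity of the content gives the bound. *)
Let open_caratheodory (U : set X) : open U -> content_outer.-caratheodory U.
Proof.
move=> oU; apply: le_caratheodory_measurable => E; apply/lee_addgt0Pr => e e0.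
have e30 : (0 < e / 3)%R by rewrite divr_gt0.
have [V [oV EV le_V]] := content_outer_adherent E e30.
have [K [cK KVU le_K]] := inner_content_adherent (V `&` U) e30.
have [L [cL LVK le_L]] := inner_content_adherent (V `\` K) e30.
have oVK : open (V `\` K) by rewrite setDE; apply: openI => //; case: (clopenC setT cK).
have le_VU : content_outer (E `&` U) <= (c K)%:E + (e / 3)%:E.
  rewrite (le_trans _ le_K)// -content_outer_open; last exact: openI.
  by apply: le_content_outer; exact: setSI.
have le_VK : content_outer (E `&` ~` U) <= (c L)%:E + (e / 3)%:E.
  rewrite (le_trans _ le_L)// -content_outer_open//; apply: le_content_outer.
  by move=> x [/EV Vx nUx]; split=> // /KVU[].
have KL0 : K `&` L = set0.
  by apply/seteqP; split=> // x [Kx /LVK[]].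
have le_KL : (c K)%:E + (c L)%:E <= content_outer E + (e / 3)%:E.
  apply: le_trans le_V; rewrite -EFinD -contentU//; apply: ereal_sup_ubound.
  exists (K `|` L) => //; split; first exact: clopenU.
  by rewrite subUset; split=> x; [move=> /KVU[] | move=> /LVK[]].
have third (x y z t : R) :
    (x + y <= z + t / 3 -> x + y + (t / 3 + t / 3) <= z + t)%R by lra.
apply: (le_trans (leeD le_VU le_VK)); rewrite addeACA.
rewrite -[X in _ <= X + _](fineK (content_outer_fin E)) -!EFinD lee_fin.
apply: third; rewrite -lee_fin !EFinD fineK//.
Qed.

Let borelX := g_sigma_algebraType (@open X).

Let borel_caratheodory (E : set borelX) :
  measurable E -> content_outer.-caratheodory E.
Proof.
apply: smallest_sub; last exact: open_caratheodory.
split=> [|A|A]; first exact: caratheodory_measurable_set0.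
- by rewrite setTD; exact: caratheodory_measurable_setC.
- exact: caratheodory_measurable_bigcup.
Qed.

Definition borel_content (E : set borelX) : \bar R := content_outer E.

Let borel_content_sigma_additive : semi_sigma_additive borel_content.
Proof.
move=> A mA tA mUA.
by apply: (@caratheodory_measure_sigma_additive R X content_outer) => //;
  [move=> i|]; exact: borel_caratheodory.
Qed.

HB.instance Definition _ := isMeasure.Build _ borelX R borel_content
  content_outer0 content_outer_ge0 borel_content_sigma_additive.

Let borel_content_fin : fin_num_fun borel_content.
Proof. by move=> E _; exact: content_outer_fin. Qed.

HB.instance Definition _ := Measure_isFinite.Build _ borelX R borel_content
  borel_content_fin.

(** Outer regularity is built into the outer measure; inner regularity follows
    by complementation, because closed sets are compact. *)
Lemma radon_extension : exists mu : {finite_measure set borelX -> \bar R},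
  [/\ forall K, clopen K -> mu K = (c K)%:E,
      forall U, open U ->
        mu U = ereal_sup [set (c K)%:E | K in [set K | clopen K /\ K `<=` U]] &
      forall (E : set borelX) (e : R), measurable E -> (0 < e)%R ->
        exists C, [/\ closed (C : set X), C `<=` E & mu E <= mu C + e%:E]].
Proof.
exists borel_content; split=> [K cK|U oU|E e mE e0].
- rewrite /= /borel_content content_outer_open; last by case: cK.
  apply/eqP; rewrite eq_le; apply/andP; split.
    by apply: ge_ereal_sup => _ [L [cL LK] <-]; rewrite lee_fin le_content.
  by apply: ereal_sup_ubound; exists K; split.
- exact: content_outer_open.
- have [U [oU EU le_U]] := content_outer_adherent (~` E) e0.
  have mU : measurable (U : set borelX) by exact: sub_sigma_algebra.
  exists (~` U); split; first exact: open_closedC.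
    by move=> x /= nUx; apply: contrapT => /EU.
  have split_T (A : set borelX) : measurable A ->
      borel_content A + borel_content (~` A) = borel_content setT.
    by move=> mA; rewrite -measureU ?setICr ?setUv//; exact: measurableC.
  rewrite -content_outer_open// in le_U.
  have arith (x y x' y' t : R) :
    (x + x' = y + y' -> y <= x' + t -> x <= y' + t)%R by lra.
  have finK (A : set X) := fineK (content_outer_fin A).
  rewrite /= /borel_content -(finK E) -(finK (~` U)) -EFinD lee_fin.
  apply: (arith _ (fine (content_outer U)) (fine (content_outer (~` E)))).
    by apply: EFin_inj; rewrite !EFinD !finK; rewrite [LHS]split_T// [RHS]split_T.
  by rewrite -lee_fin EFinD !finK.
Qed.

End clopen_content.

(** * The clopen algebra of the remainder *)

Lemma UltraFilter_dichotomy (T : Type) (F : set_system T) : ProperFilter F ->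
  (forall A, F A \/ F (~` A)) -> UltraFilter F.
Proof.
move=> PF FA; split=> // G PG FG; apply/seteqP; split=> // A GA.
have [//|/FG GnA] := FA A.
by have /filter_ex[x []] : G (A `&` ~` A) by exact: filterI.
Qed.

Lemma AstarC (A : set nat) : Astar (~` A) = ~` Astar A.
Proof. by rewrite !AstarE; apply/seteqP; split=> y /=; rewrite ultra_setC. Qed.

Lemma AstarI (A B : set nat) : Astar (A `&` B) = Astar A `&` Astar B.
Proof.
rewrite !AstarE; apply/seteqP; split=> y /=.
  by move=> yAB; split; apply: filterS yAB => n [].
by move=> [yA yB]; exact: filterI.
Qed.

Lemma AstarU (A B : set nat) : Astar (A `|` B) = Astar A `|` Astar B.
Proof. by apply: setC_inj; rewrite setCU -!AstarC -AstarI setCU. Qed.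

Lemma open_Astar (A : set nat) : open (Astar A).
Proof.
rewrite AstarE (_ : mkset _ = Nstar_val @^-1` [set p : betaN | ultra p A])//.
apply: open_comp; last exact: open_betaN.
by move=> y _; exact: (@initial_continuous Nstar betaN Nstar_val).
Qed.

Lemma clopen_Astar (A : set nat) : clopen (Astar A).
Proof.
split; first exact: open_Astar.
by rewrite -[A]setCK AstarC; apply: open_closedC; exact: open_Astar.
Qed.

Lemma nbhs_Astar (y : Nstar) U : nbhs y U ->
  exists A, Astar A y /\ Astar A `<=` U.
Proof.
rewrite nbhsE => -[_ [[V oV <-] Vy] VU].
have /nbhs_betaN[A yA AV] : nbhs (Nstar_val y) V.
  by apply: open_nbhs_nbhs; split.
by exists A; rewrite AstarE; split=> // z zA; apply: VU; exact: AV.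
Qed.

(** An ultrafilter on the remainder converges to the trace that it leaves on
    the sets of integers; this trace is free because every point is. *)
Lemma compact_Nstar : compact [set: Nstar].
Proof.
rewrite compact_ultra => F UF _.
pose p : set_system nat := [set A | F (Astar A)].
have Pp : ProperFilter p.
  split; last split.
  - rewrite /p /= AstarE => /filter_ex[y y0].
    exact: (@filter_not_empty _ (Nstar_val y)).
  - by rewrite /p /= AstarE; apply: filterS filterT => y _; exact: filterT.
  - by move=> A B pA pB; rewrite /p /= AstarI; exact: filterI.
  - move=> A B AB; rewrite /p /= !AstarE; apply: filterS => y /=.
    exact: filterS.
have Up : UltraFilter p.
  apply: UltraFilter_dichotomy => A; rewrite /p /= AstarC.
  exact: in_ultra_setVsetC.
have free : (~` range principal) (BetaN Up).
  move=> [n _ pn]; have : p [set n].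
    by rewrite -[p]/(ultra (BetaN Up)) -pn; exact/principal_filterP.
  by rewrite /p /= AstarE => /filter_ex[y]; exact: Nstar_free.
exists (exist _ (BetaN Up) (mem_set free)); split=> // U /nbhs_Astar[A [yA AU]].
by rewrite AstarE in yA; apply: (filterS AU).
Qed.

Lemma clopen_AstarP (K : set Nstar) : clopen K <-> exists A, K = Astar A.
Proof.
split=> [[oK cK]|[A ->]]; last exact: clopen_Astar.
have cptK : compact K by exact: subclosed_compact cK compact_Nstar _.
have /choice[f fP] : forall y, exists A, K y -> Astar A y /\ Astar A `<=` K.
  move=> y; have [Ky|nKy] := pselect (K y); last by exists set0.
  by have [A AP] := nbhs_Astar (open_nbhs_nbhs (conj oK Ky)); exists A.
move: cptK; rewrite compact_cover => /(_ _ K (fun y => Astar (f y))).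
case=> [y _|y Ky|D DK KD]; first exact: open_Astar.
  by exists y => //; case: (fP _ Ky).
exists (\big[setU/set0]_(y <- finmap.enum_fset D) f y).
have -> : Astar (\big[setU/set0]_(y <- finmap.enum_fset D) f y) =
    \big[setU/set0]_(y <- finmap.enum_fset D) Astar (f y).
  apply: (big_morph Astar AstarU).
  by rewrite AstarE; apply/seteqP; split=> // y; exact: filter_not_empty.
rewrite -bigcup_seq; apply/seteqP; split=> y; first by move=> /KD.
move=> [z /= zD zy]; have /set_mem/fP[_] := DK _ zD; exact.
Qed.

(** The cofinite subsets of [A] generate a proper filter, and any ultrafilter
    that refines it is free and contains [A]. *)
Lemma infinite_Astar (A : set nat) : infinite_set A -> Astar A !=set0.
Proof.
move=> infA; have PF : ProperFilter (within A \oo).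
  split; last exact: within_filter.
  move=> [N _ AN]; apply: infA; apply: (sub_finite_set _ (finite_II N)) => n An /=.
  by rewrite ltnNge; apply/negP => Nn; exact: (AN n).
have [F [UF sF]] := ultraFilterLemma PF.
have free : (~` range principal) (BetaN UF).
  move=> [n _ Fn]; have : F (~` [set n]).
    by apply: sF; exists n.+1 => // m /= nm _ mn; rewrite mn ltnn in nm.
  by rewrite -[F]/(ultra (BetaN UF)) -Fn => /principal_filterP; exact.
exists (exist _ (BetaN UF) (mem_set free)); rewrite AstarE /=.
by apply: sF; exists 0%N.
Qed.

Lemma sub_Astar (A B : set nat) :
  Astar A `<=` Astar B <-> finite_set (A `\` B).
Proof.
split=> [AB|fAB y].
  apply: contrapT => /infinite_Astar[y]; rewrite setDE AstarI AstarC.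
  by move=> [/AB].
rewrite !AstarE /= => yA; apply: contrapT => /ultra_setC ynB.
apply: (Nstar_finite (y := y) fAB); rewrite setDE; exact: filterI.
Qed.

Lemma Astar0P (A : set nat) : Astar A = set0 <-> finite_set A.
Proof.
rewrite -[A in finite_set A]setD0 -sub_Astar.
have -> : Astar set0 = set0.
  by rewrite AstarE; apply/seteqP; split=> // y; exact: filter_not_empty.
by split=> [->//|]; rewrite subset0.
Qed.

(** * Bounded functions and their extensions to the remainder *)

Section indicator.
Context (R : realType) (I : Type).

Lemma indic_linf_subproof (A : set I) : (\1_A : I -> R) \in linf_pred R I.
Proof.
by apply/linf_predP; exists 1 => i; rewrite indicE ger0_norm ?ler0n// lern1 leq_b1.
Qed.

Definition indic_linf (A : set I) : linf R I := Linf (indic_linf_subproof A).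

(** Halving argument: if [0 <= f <= N], subtracting [N / 2] on the level set
    where [f] is at least [N / 2] leaves a function with values between [0] and
    [N / 2], and a functional that vanishes on indicators does not see it. *)
Lemma scalar_eq0 (D : linf R I -> R) (M : R) : scalar D -> 0 <= M ->
  (forall f, `|D f| <= M * `|f|) -> (forall A, D (indic_linf A) = 0) ->
  forall f, D f = 0.
Proof.
move=> lD M0 bD D1.
have D0 : D 0 = 0 by have := lD (-1) 0 0; rewrite scaler0 addr0 mulN1r addNr.
have D_ge0 n : forall (N : R) (f : linf R I), 0 <= N ->
    (forall i, 0 <= f i <= N) -> `|D f| <= M * (N / 2 ^+ n).
  elim: n => [|n IHn] N f N0 fN.
    rewrite expr0 divr1 (le_trans (bD f))// ler_wpM2l//.
    apply: linf_norm_le => // i; have /andP[f0 fi] := fN i.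
    by rewrite ger0_norm.
  pose A := [set i | N / 2 <= f i]; pose g := (- (N / 2)) *: indic_linf A + f.
  have -> : D f = D g by rewrite lD D1 mulr0 add0r.
  rewrite exprS invfM (mulrA N); apply: IHn; first by rewrite divr_ge0.
  move=> i; have /andP[f0 fi] := fN i; rewrite /g /= !fctE indicE.
  rewrite /GRing.scale /=; have [/set_mem Ai|/negP nAi] := boolP (i \in A) => /=.
    have {}Ai : N / 2 <= f i by exact: Ai.
    by apply/andP; split; lra.
  have {}nAi : f i < N / 2.
    by rewrite ltNge; apply/negP => Ai; apply: nAi; rewrite inE.
  by apply/andP; split; lra.
have D_eq0 (f : linf R I) : (forall i, 0 <= f i) -> D f = 0.
  move=> f0; apply/eqP; rewrite -normr_le0; apply/ler_addgt0Pr => e e0.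
  rewrite add0r.
  (* M * |f| / 2^n tends to zero, and n < 2^n makes it explicit *)
  have [n ltn] : exists n : nat, M * `|f| / e <= n%:R.
    by exists (Num.bound (M * `|f| / e)); apply/ltW/archi_boundP;
      rewrite divr_ge0 ?mulr_ge0 ?(ltW e0).
  apply: (le_trans (D_ge0 n `|f| f _ _)) => //.
    by move=> i; rewrite f0/= (le_trans (ler_norm _))//; exact: le_linf_norm.
  rewrite mulrA ler_pdivrMr ?exprn_gt0// [leRHS]mulrC -ler_pdivrMr//.
  by rewrite (le_trans ltn)// -natrX ler_nat ltnW// ltn_expl.
(* shifting by the constant |f| makes any bounded function nonnegative *)
move=> f; pose one := `|f| *: indic_linf setT.
have -> : f = (f + one) - one by rewrite addrK.
have D_one : D one = 0 by rewrite -[one]addr0 lD D1 D0 mulr0 addr0.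
have -> : f + one - one = (-1) *: one + (f + one) by rewrite scaleN1r addrC.
rewrite lD D_one mulr0 add0r D_eq0// => i.
rewrite /= !fctE indicE in_setT /GRing.scale /= mulr1.
have := le_linf_norm f i; rewrite ler_norml => /andP[le_f _].
by rewrite -lerBlDr sub0r.
Qed.

End indicator.

Section extension_theory.
Context (R : realType).
Implicit Types (f g : linf R nat) (p : betaN) (q : linf_c0 R nat).

Lemma beta_ext_eq f p (l : R) : f @ ultra p --> l -> beta_ext f p = l.
Proof. by move=> fl; exact: (cvg_unique _ (@beta_ext_cvg R f p) fl). Qed.

Lemma beta_ext_scalar p : scalar (fun f => beta_ext f p).
Proof.
move=> a f g; apply: beta_ext_eq; apply: cvgD; last exact: beta_ext_cvg.
by apply: cvgZr; exact: beta_ext_cvg.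
Qed.

Lemma beta_ext_ge0 f p : (forall n, 0 <= f n) -> 0 <= beta_ext f p.
Proof.
by move=> f0; apply: (cvgr_to_ge (@beta_ext_cvg R f p)); exact: nearW.
Qed.

Lemma le_beta_ext_norm f p : `|beta_ext f p| <= `|f|.
Proof.
apply: (cvgr_to_le (cvg_norm (@beta_ext_cvg R f p))).
by apply: nearW => n; exact: le_linf_norm.
Qed.

Lemma star_scalar y : scalar (fun q : linf_c0 R nat => star q y).
Proof.
move=> a q r; rewrite -(cls_repr q) -(cls_repr r) -clsZ -clsD !star_cls.
exact: beta_ext_scalar.
Qed.

Lemma star_indic A y : star (cls (indic_linf R A)) y = \1_(Astar A) y.
Proof.
rewrite star_cls; apply: beta_ext_eq; rewrite indicE AstarE.
apply: (@cvg_trans _ ((fun=> (y \in [set y | ultra (Nstar_val y) A])%:R : R) @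
  ultra (Nstar_val y))); last exact: cvg_cst.
apply: near_eq_cvg; have [yA|ynA] := pselect (ultra (Nstar_val y) A).
  by rewrite mem_set//; apply: filterS yA => n An /=; rewrite indicE mem_set.
rewrite memNset//; have /ultra_setC ynC := ynA.
by apply: filterS ynC => n An /=; rewrite indicE memNset.
Qed.

End extension_theory.

(** * Positive functionals are Radon measures *)

Section positive_charge.
Context d (T : measurableType d) (R : realType).
Context (mu : {finite_measure set T -> \bar R}) (P N : set T).
Context (PN : hahn_decomposition (charge_of_finite_measure mu) P N).

Let negative0 E : measurable E -> mu (E `&` N) = 0%E.
Proof.
move=> mE; have [_ [mN nN] _ _] := PN.
apply/eqP; rewrite eq_le measure_ge0 andbT.
by apply: nN; [exact: measurableI | exact: subIsetr].
Qed.

(** The chosen negative set of a positive measure need not be empty, but it is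
    null. *)
Lemma jordan_neg_measure E : measurable E -> jordan_neg PN E = 0%E.
Proof.
move=> mE; rewrite jordan_negE cjordan_negE /crestr0 mem_set// /crestr.
by apply/eqP; rewrite oppe_eq0; apply/eqP; exact: negative0.
Qed.

Lemma jordan_pos_measure E : measurable E -> jordan_pos PN E = mu E.
Proof.
move=> mE; have := jordan_decomp PN mE.
have -> : cadd (jordan_pos PN) (cscale (-1) (jordan_neg PN)) E =
    (jordan_pos PN E + (-1)%:E * jordan_neg PN E)%E by [].
by rewrite jordan_neg_measure// mule0 adde0 => <-.
Qed.

Lemma charge_variation_measure E : measurable E ->
  charge_variation PN E = mu E.
Proof.
move=> mE.
have -> : charge_variation PN E = (jordan_pos PN E + jordan_neg PN E)%E by [].
by rewrite jordan_pos_measure// jordan_neg_measure// adde0.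
Qed.

End positive_charge.

Section riesz.
Context (R : realType).

Lemma measurable_star (q : linf_c0 R nat) :
  measurable_fun [set: borelNstar] (star q).
Proof.
apply: (measurability _ (measurable_realfun.RGenOpens.measurableE R)).
move=> _ [_ [a [b ->] <-]]; rewrite setTI.
apply: sub_sigma_algebra; apply: open_comp; last exact: interval_open.
by move=> y _; exact: star_continuous.
Qed.

Lemma integrable_star (mu : {finite_measure set borelNstar -> \bar R}) q :
  mu.-integrable setT (EFin \o star q).
Proof.
apply: measurable_bounded_integrable => //; first exact: fin_num_fun_lty.
  exact: measurable_star.
exists `|repr q|; split=> // M ltM y _.
exact: le_trans (le_beta_ext_norm _ _) (ltW ltM).
Qed.

Lemma charge_integral_measure (mu : {finite_measure set borelNstar -> \bar R}) g :
  charge_integral (charge_of_finite_measure mu) g = \int[mu]_x g x.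
Proof.
rewrite /charge_integral /Rintegral.
rewrite (eq_measure_integral mu); last first.
  by move=> E mE _; exact: jordan_pos_measure.
rewrite [X in _ - fine X](eq_measure_integral mzero); last first.
  by move=> E mE _; exact: jordan_neg_measure.
by rewrite integral_measure_zero subr0.
Qed.

Lemma eq_cls I (f g : linf R I) (N : set I) : finite_set N ->
  (forall i, ~ N i -> f i = g i) -> cls f = cls g.
Proof.
move=> finN fg; apply/clsP/c0P => e e0; apply: sub_finite_set finN => i /= le_e.
apply: contrapT => /fg fgi; move: le_e.
by rewrite !fctE fgi subrr normr0 leNgt e0.
Qed.

Lemma hausdorff_Nstar : hausdorff_space Nstar.
Proof.
move=> y z yz; apply/val_inj/betaN_eq.
apply: (@max_filter _ _ (ultraP (Nstar_val z))) => A zA.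
apply: contrapT => /ultra_setC ynA.
have nbhs_ultra B (x : Nstar) : ultra (Nstar_val x) B -> nbhs x (Astar B).
  by move=> xB; apply: open_nbhs_nbhs; split; [exact: open_Astar | rewrite AstarE].
have [x []] := yz _ _ (nbhs_ultra _ _ ynA) (nbhs_ultra _ _ zA).
by rewrite AstarC.
Qed.

(** Riesz representation on the remainder: the functional restricts to a
    content on the clopen sets, the content extends to a Radon measure, and
    both sides of the representation agree on indicators. *)
Lemma riesz_Nstar (phi : linf_c0 R nat -> R) : scalar phi ->
    (forall f : linf R nat, (forall n, 0 <= f n) -> 0 <= phi (cls f)) ->
  exists mu : {finite_measure set borelNstar -> \bar R},
    represents (charge_of_finite_measure mu) phi /\
    forall U : set Nstar, open U -> mu U =
      ereal_sup [set (phi (cls (indic_linf R A)))%:E |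
                 A in [set A | Astar A `<=` U]].
Proof.
move=> lphi phi_ge0.
have phiD p q : phi (p + q) = phi p + phi q.
  by have := lphi 1 p q; rewrite scale1r mul1r.
have phi0 : phi 0 = 0 by apply: (addrI (phi 0)); rewrite -phiD !addr0.
have phiZ a q : phi (a *: q) = a * phi q.
  by have := lphi a q 0; rewrite phi0 !addr0.
pose m A := phi (cls (indic_linf R A)).
have m_ge0 A : 0 <= m A by apply: phi_ge0 => n; rewrite /= indicE.
have m_Astar A B : Astar A = Astar B -> m A = m B.
  move=> AB; congr phi; apply: (@eq_cls _ _ _ ((A `\` B) `|` (B `\` A))).
    by rewrite finite_setU; split; apply/sub_Astar; rewrite AB.
  move=> n nAB; rewrite /= !indicE.
  have [An|nAn] := boolP (n \in A); have [Bn|nBn] := boolP (n \in B) => //.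
    by case: nAB; left; split; [exact: set_mem | move=> /mem_set; exact/negP].
  by case: nAB; right; split; [exact: set_mem | move=> /mem_set; exact/negP].
(* every clopen set is some A^*; the content does not depend on the choice *)
pose c (K : set Nstar) := m (xget set0 [set A | Astar A = K]).
have cE A : c (Astar A) = m A.
  by apply: m_Astar; apply: (xgetPex set0 (P := [set B | Astar B = Astar A])); exists A.
have base (y : Nstar) U : nbhs y U -> exists K, [/\ clopen K, K y & K `<=` U].
  by move=> /nbhs_Astar[A [Ay AU]]; exists (Astar A); split=> //; exact: clopen_Astar.
have c_ge0 K : clopen K -> 0 <= c K by move=> _; exact: m_ge0.
have cU (K L : set Nstar) : clopen K -> clopen L -> K `&` L = set0 ->
    c (K `|` L) = c K + c L.
  move=> /clopen_AstarP[A ->] /clopen_AstarP[B ->].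
  rewrite -AstarI -AstarU !cE => /Astar0P finAB.
  rewrite /m -phiD -clsD; congr phi; apply: (eq_cls finAB) => n nAB.
  rewrite /= !fctE !indicE in_setU.
  have [An|nAn] := boolP (n \in A); have [Bn|nBn] := boolP (n \in B) => /=;
    rewrite ?addr0 ?add0r//.
  by case: nAB; split; exact: set_mem.
have [mu [muK muU mu_reg]] := radon_extension compact_Nstar base c_ge0 cU.
exists mu; split; last first.
  move=> U /muU ->; congr ereal_sup; apply/seteqP; split=> x [K].
    by case=> /clopen_AstarP[A EK] KU <-; exists A; [rewrite /= -EK | rewrite EK cE].
  by move=> AU <-; exists (Astar K); [split=> //; exact: clopen_Astar | rewrite cE].
split.
  move=> E mE; rewrite charge_variation_measure//; apply/eqP; rewrite eq_le.
  apply/andP; split.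
    apply/lee_addgt0Pr => e e0; have [C [clC CE le_C]] := mu_reg _ _ mE e0.
    apply: (le_trans le_C); rewrite leeD2r//; apply: ereal_sup_ubound.
    exists C; first by split=> //; exact: subclosed_compact clC compact_Nstar _.
    rewrite charge_variation_measure//; rewrite -[C]setCK; apply: measurableC.
    by apply: sub_sigma_algebra; exact: closed_openC.
  apply: ge_ereal_sup => _ [K [cptK KE] <-].
  have mK : measurable (K : set borelNstar).
    rewrite -[K]setCK; apply: measurableC; apply: sub_sigma_algebra.
    by apply: closed_openC; exact: compact_closed hausdorff_Nstar cptK.
  by rewrite charge_variation_measure// le_measure ?inE.
move=> q; rewrite charge_integral_measure -(cls_repr q).
apply/eqP; rewrite -subr_eq0; apply/eqP; move: (repr q) => f {q}.
pose D (f : linf R nat) := phi (cls f) - \int[mu]_x star (cls f) x.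
apply: (@scalar_eq0 _ _ D (m setT + fine (mu setT))).
- move=> a g h; rewrite /D clsD clsZ lphi.
  under eq_Rintegral do rewrite star_scalar.
  have int_g := integrable_star mu (cls g).
  rewrite RintegralD//; [|exact: (integrableZl measurableT a int_g)|exact: integrable_star].
  rewrite RintegralZl//.
  ring.
- by rewrite addr_ge0// fine_ge0.
- have le_phi (g : linf R nat) : phi (cls g) <= m setT * `|g|.
    rewrite -subr_ge0 mulrC -phiZ -mulN1r -phiZ -phiD -!clsZ -clsD.
    apply: phi_ge0 => n; rewrite /= !fctE indicE in_setT /GRing.scale /=.
    rewrite mulr1 mulN1r subr_ge0.
    by rewrite (le_trans (ler_norm _))//; exact: le_linf_norm.
  move=> g; rewrite mulrDl (le_trans (ler_normB _ _))// lerD//.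
    rewrite ler_norml le_phi andbT lerNl -mulN1r -phiZ -clsZ scaleN1r.
    by rewrite (le_trans (le_phi _))// normrN.
  have int_g := integrable_star mu (cls g).
  rewrite (le_trans (le_normr_Rintegral _ _))// mulrC -Rintegral_cst//.
  apply: le_Rintegral => //.
  + exact: integrable_norm.
  + exact: finite_measure_integrable_cst.
  + by move=> y _; rewrite star_cls; exact: le_beta_ext_norm.
- move=> A; rewrite /D -/(m A) -cE.
  under eq_Rintegral do rewrite star_indic.
  rewrite /Rintegral integral_indic// ?setIT; last first.
    by apply: sub_sigma_algebra; exact: open_Astar.
  by rewrite [X in fine X](muK _ (clopen_Astar A)) subrr.
Qed.

End riesz.

(** * Null sequences under change of index set *)

Section null_sequences.
Context (R : realType).

Lemma cls_eq0 I (f : linf R I) : cls f = 0 <-> f \in c0.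
Proof. by rewrite -cls0 clsP subr0. Qed.

Lemma c0_le I (f g : linf R I) : (forall i, `|f i| <= `|g i|) ->
  g \in c0 -> f \in c0.
Proof.
move=> fg /c0P g0; apply/c0P => e e0; apply: sub_finite_set (g0 _ e0) => i /=.
by move=> /le_trans; apply.
Qed.

Lemma indic_c0 I (A : set I) : finite_set A -> indic_linf R A \in c0.
Proof.
move=> finA; apply/cls_eq0; rewrite -cls0; apply: (eq_cls finA) => i nAi.
by rewrite /= indicE memNset.
Qed.

Context (J I : Type) (e : J -> I).
Context (inj_e : injective e).

Lemma ext0_funE (h : J -> R) j : ext0_fun e h (e j) = h j.
Proof.
rewrite /ext0_fun; case: pselect => [ex|[]]; last by exists j.
by congr h; apply: inj_e; exact: (svalP (cid ex)).
Qed.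

Lemma ext0_indic (D : set J) : ext0 e (indic_linf R D) = indic_linf R (e @` D).
Proof.
apply/val_inj/funext => i; have [[j <-]|nex] := pselect (exists j, e j = i).
  rewrite /= ext0_funE !indicE; congr (_%:R); congr nat_of_bool.
  apply/idP/idP; rewrite !inE; first by move=> Dj; exists j.
  by move=> [k Dk /inj_e <-].
rewrite [LHS]ext0_out//= indicE memNset//.
by move=> [j _ ji]; apply: nex; exists j.
Qed.

Lemma ext0q0 : ext0q e (0 : linf_c0 R J) = 0.
Proof.
rewrite -cls0 ext0q_cls -cls0; congr cls; apply/val_inj/funext => i /=.
by rewrite /ext0_fun; case: pselect.
Qed.

Lemma resq0 : resq e (0 : linf_c0 R I) = 0.
Proof.
by rewrite -cls0 resq_cls// -cls0; congr cls; apply/val_inj/funext.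
Qed.

End null_sequences.

Lemma subfun_inj (T : Type) (A' A : set T) (sA : A' `<=` A) :
  injective (subfun sA).
Proof. by move=> x y /(congr1 val) /= /val_inj. Qed.

(** * Averages over dyadic blocks *)

Section dyadic_average.
Context (R : realType).
Implicit Types (f g : linf R nat) (A C : set nat).

Definition avg_fun (f : nat -> R) (i : nat) : R :=
  (2 ^+ i)^-1 * \sum_(j < 2 ^ i) f (2 ^ i + j)%N.

Lemma avg_fun_cst (a : R) i : avg_fun (fun=> a) i = a.
Proof.
by rewrite /avg_fun sumr_const card_ord -[a *+ _]mulr_natl natrX mulKf.
Qed.

Lemma le_avg_fun (f g : nat -> R) i :
  (forall j, (2 ^ i <= j)%N -> f j <= g j) -> avg_fun f i <= avg_fun g i.
Proof.
move=> fg; rewrite /avg_fun ler_wpM2l ?invr_ge0 ?exprn_ge0//.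
by apply: ler_sum => j _; apply: fg; exact: leq_addr.
Qed.

Lemma avg_fun_norm_le (f : nat -> R) i e :
  (forall j, (2 ^ i <= j)%N -> `|f j| <= e) -> `|avg_fun f i| <= e.
Proof.
move=> fe; rewrite ler_norml; apply/andP.
by split; [rewrite -[- e](avg_fun_cst _ i) | rewrite -[leRHS](avg_fun_cst _ i)];
   apply: le_avg_fun => j /fe; rewrite ler_norml => /andP[].
Qed.

Lemma avg_subproof f : avg_fun f \in linf_pred R nat.
Proof.
apply/linf_predP; exists `|f| => i; apply: avg_fun_norm_le => j _.
exact: le_linf_norm.
Qed.

Definition avg f : linf R nat := Linf (avg_subproof f).

Lemma avg_norm_le f : `|avg f| <= `|f|.
Proof.
apply: linf_norm_le => // i; apply: avg_fun_norm_le => j _.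
exact: le_linf_norm.
Qed.

Lemma avg_linear : linear avg.
Proof.
move=> a f g; apply/val_inj/funext => i /=.
rewrite /avg_fun !fctE /avg_fun big_split/= mulrDr; congr (_ + _).
rewrite /GRing.scale /= mulrCA; congr (_ * _).
by rewrite mulr_sumr; apply: eq_bigr => j _.
Qed.

(** The i-th block lies beyond [i]. *)
Lemma avg_c0 f : f \in c0 -> avg f \in c0.
Proof.
move=> /c0P f0; apply/c0P => e e0.
have e20 : 0 < e / 2 by rewrite divr_gt0.
have [N ltN] : exists N : nat, forall j, e / 2 <= `|f j| -> (j < N)%N.
  have /finite_seqP[s sE] := f0 _ e20.
  exists (\max_(j <- s) j).+1 => j le_j; rewrite ltnS.
  apply: (@leq_bigmax_seq _ s xpredT id) => //.
  by have : [set` s] j by rewrite -sE.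
apply: (sub_finite_set _ (finite_II N)) => i /= le_e; rewrite ltnNge; apply/negP => Ni.
have : `|avg_fun f i| <= e / 2.
  apply: avg_fun_norm_le => j ij; rewrite leNgt; apply/negP => /ltW/ltN.
  by rewrite ltnNge (leq_trans Ni)// (leq_trans _ ij)// ltnW// ltn_expl.
by move=> /(le_trans le_e); lra.
Qed.

Definition avgq (q : linf_c0 R nat) : linf_c0 R nat := cls (avg (repr q)).

Lemma avgB f g : avg (f - g) = avg f - avg g.
Proof. by rewrite addrC -scaleN1r avg_linear scaleN1r addrC. Qed.

Lemma avgq_cls f : avgq (cls f) = cls (avg f).
Proof.
by apply/clsP; rewrite -avgB; apply: avg_c0; apply/clsP; exact: cls_repr.
Qed.

Lemma avgq_linear : linear avgq.
Proof.
move=> a p q; rewrite -(cls_repr p) -(cls_repr q) -clsZ -clsD !avgq_cls.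
by rewrite avg_linear clsD clsZ.
Qed.

HB.instance Definition _ :=
  GRing.isLinear.Build R (linf_c0 R nat) (linf_c0 R nat) *:%R avgq avgq_linear.

Lemma avgq_bounded : bounded_operator avgq.
Proof.
exists 1 => q; rewrite mul1r; apply/ler_addgt0Pr => e e0.
have [f <- /ltW lt_f] := linf_c0_norm_adherent q e0.
rewrite avgq_cls; apply: le_trans (linf_c0_norm_le _) _.
exact: le_trans (avg_norm_le _) lt_f.
Qed.

Definition block_coef (i j : nat) : R :=
  if (2 ^ i <= j < 2 ^ i.+1)%N then (2 ^+ i)^-1 else 0.

Lemma series_block (f : nat -> R) i n : (2 ^ i.+1 <= n)%N ->
  series (fun j => block_coef i j * f j) n = avg_fun f i.
Proof.
move=> lt_n; rewrite /series /= (big_cat_nat (n := 2 ^ i.+1))//=.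
rewrite [X in _ + X]big_nat_cond [X in _ + X]big1 ?addr0; last first.
  move=> j; rewrite andbT => /andP[lt_j _].
  by rewrite /block_coef [(j < _)%N]ltnNge lt_j andbF mul0r.
have le2 : (2 ^ i <= 2 ^ i.+1)%N by rewrite leq_exp2l.
rewrite (big_cat_nat (n := 2 ^ i))//=.
rewrite [X in X + _]big_nat_cond [X in X + _]big1 ?add0r; last first.
  by move=> j; rewrite andbT => /andP[_ lt_j]; rewrite /block_coef leqNgt lt_j mul0r.
rewrite /avg_fun mulr_sumr -{1}[(2 ^ i)%N]add0n expnS mul2n -addnn.
rewrite big_addn addnK big_mkord.
apply: eq_bigr => j _.
rewrite addnC /block_coef leq_addr expnS mul2n -addnn ltn_add2l.
by rewrite ltn_ord.
Qed.

Lemma avgq_matrix : matrix_operator avgq.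
Proof.
have injT : injective (set_val : [set: nat] -> nat) by exact: val_inj.
pose b (i j : [set: nat]) := block_coef (set_val i) (set_val j).
pose g (f : linf R [set: nat]) : linf R [set: nat] :=
  res set_val (avg (ext0 set_val f)).
have sends h : matrix_sends b h (g h).
  move=> i; apply: cvg_near_cst; exists (2 ^ (set_val i).+1)%N => // n /= le_n.
  rewrite -(series_block (ext0 set_val h) le_n); congr (series _ n).
  apply/funext => j; have -> : j = set_val (exist _ j (mem_set I) : [set: nat]) by [].
  by rewrite /= !ext0_funE.
have gE h : P_ setT (avgq (I_ setT (cls h))) = cls (g h).
  by rewrite /P_ /I_ ext0q_cls avgq_cls resq_cls.
have cofT : cofinite [set: nat] by split=> //; rewrite setDv; exact: finite_set0.
exists setT, setT, b; split=> //; last by move=> h; exists (g h).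
exists 1 => h h0; exists (g h); split; [|exact: sends|].
  apply/cls_eq0; rewrite -gE; move/cls_eq0: h0 => ->.
  by rewrite /I_ ext0q0 linear0 /P_ resq0.
rewrite mul1r; apply: linf_norm_le => // i.
apply: le_trans (le_linf_norm (avg _) _) _; apply: le_trans (avg_norm_le _) _.
apply: linf_norm_le => // j; rewrite /= /ext0_fun.
by case: pselect => [ex|_]; [exact: le_linf_norm | rewrite normr0].
Qed.

(** * Sparse sets *)

(** The sets of block density zero. *)
Definition sparse A := avg (indic_linf R A) \in c0.

Lemma finite_sparse A : finite_set A -> sparse A.
Proof. by move=> finA; apply: avg_c0; exact: indic_c0. Qed.

Lemma sparse_subU A C D : A `<=` C `|` D -> sparse C -> sparse D -> sparse A.
Proof.
move=> ACD sC sD.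
have sCD : avg (indic_linf R C + indic_linf R D) \in c0.
  have -> : avg (indic_linf R C + indic_linf R D) =
      avg (indic_linf R C) + avg (indic_linf R D).
    by have := avg_linear 1 (indic_linf R C) (indic_linf R D); rewrite !scale1r.
  exact: rpredD.
apply: c0_le sCD => i; rewrite ger0_norm; last first.
  rewrite -(avg_fun_cst 0 i); apply: le_avg_fun => j _.
  by rewrite /= indicE ler0n.
apply: le_trans (ler_norm _); apply: le_avg_fun => j _.
rewrite /= !fctE !indicE; have [/set_mem/ACD[Cj|Dj]|_] := boolP (j \in A).
- by rewrite (mem_set Cj) lerDl ler0n.
- by rewrite (mem_set Dj) lerDr ler0n.
- by rewrite addr_ge0// ler0n.
Qed.

Lemma avgq_sparse A : sparse A -> avgq (cls (indic_linf R A)) = 0.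
Proof. by move=> sA; rewrite avgq_cls; apply/cls_eq0. Qed.

Lemma infinite_unbounded A : infinite_set A ->
  forall N : nat, exists2 a, A a & (N <= a)%N.
Proof.
move=> infA N; apply: contrapT => noA; apply: infA.
apply: (sub_finite_set _ (finite_II N)) => a Aa /=.
by rewrite ltnNge; apply/negP => Na; apply: noA; exists a.
Qed.

Lemma pow2_unbounded (x : R) : exists N : nat, forall i, 2 ^+ i <= x -> (i < N)%N.
Proof.
exists (Num.bound `|x|) => i le_x; rewrite -(ltr_nat R).
apply: le_lt_trans (archi_boundP (normr_ge0 x)).
apply: le_trans (ler_norm x); apply: le_trans le_x.
by rewrite -natrX ler_nat ltnW// ltn_expl.
Qed.

(** One point per dyadic block suffices: the least point of the set in each
    block that it meets. *)
Lemma infinite_sparse_subset A : infinite_set A ->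
  exists C, [/\ C `<=` A, infinite_set C & sparse C].
Proof.
move=> infA.
pose C := [set a | A a /\
  forall i b, A b -> (2 ^ i <= b < a)%N -> (2 ^ i.+1 <= a)%N].
exists C; split; first by move=> a [].
- move=> /finite_seqP[s CE].
  (* the least point of A above 2^N belongs to C, and lies above N *)
  pose N := (\max_(j <- s) j).+1.
  have ltN a : C a -> (a < N)%N.
    rewrite CE ltnS => sa.
    exact: (@leq_bigmax_seq _ s xpredT id).
  have [a Aa le_a] := infinite_unbounded infA (2 ^ N).
  have exP : exists m, `[< A m /\ (2 ^ N <= m)%N >] by exists a; apply/asboolP.
  case: (ex_minnP exP) => m /asboolP[Am le_m] min_m.
  have [i [Ni /andP[le_im lt_mi]]] : exists i, (N <= i)%N /\ (2 ^ i <= m < 2 ^ i.+1)%N.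
    exists (trunc_log 2 m).
    have m_gt0 : (0 < m)%N by rewrite (leq_trans _ le_m)// expn_gt0.
    split; first exact: trunc_log_max.
    by rewrite trunc_logP// trunc_log_ltn.
  have : C m.
    split=> // k b Ab /andP[le_kb lt_bm].
    have lt_bN : (b < 2 ^ N)%N.
      rewrite ltnNge; apply/negP => Nb.
      have : (m <= b)%N by apply: min_m; apply/asboolP.
      by rewrite leqNgt lt_bm.
    have lt_kN : (k < N)%N by rewrite -(@ltn_exp2l 2)// (leq_ltn_trans le_kb).
    by rewrite (leq_trans _ le_m)// leq_exp2l.
  move=> /ltN; rewrite ltnNge (leq_trans _ le_m)//.
  by rewrite ltnW// ltn_expl.
- apply/c0P => e e0.
  have [N ltN] := pow2_unbounded e^-1.
  apply: (sub_finite_set _ (finite_II N)) => i /= le_e; apply: ltN.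
  have i2 : 0 < 2 ^+ i :> R by rewrite exprn_gt0.
  (* C has at most one point in the i-th block *)
  suff : avg_fun \1_C i <= (2 ^+ i)^-1.
    rewrite ger0_norm in le_e; last first.
      by rewrite -(avg_fun_cst 0 i); apply: le_avg_fun => j _; rewrite indicE.
    by move=> /(le_trans le_e) le_i; rewrite -[_ ^+ _]invrK lef_pV2// posrE invr_gt0.
  rewrite /avg_fun -[leRHS]mulr1 ler_wpM2l ?invr_ge0 ?(ltW i2)//.
  have [[j Cj]|nC] := pselect (exists j : 'I_(2 ^ i), C (2 ^ i + j)%N); last first.
    rewrite big1// => j _; rewrite indicE memNset// => Cj.
    by apply: nC; exists j.
  rewrite (bigD1 j)//= big1 ?addr0; first by rewrite indicE (mem_set Cj).
  have no_lt (k l : 'I_(2 ^ i)) : C (2 ^ i + k)%N -> C (2 ^ i + l)%N -> ~ (k < l)%N.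
    move=> [Ak _] [_ /(_ i _ Ak)] + kl.
    rewrite leq_addr ltn_add2l kl => /(_ isT).
    by rewrite expnS mul2n -addnn leq_add2l leqNgt ltn_ord.
  move=> k kj; rewrite indicE memNset// => Ck.
  have : (k : nat) != j by [].
  by rewrite neq_ltn => /orP[]; apply/negP; apply/negP => ?;
    [exact: (no_lt k j) | exact: (no_lt j k)].
Qed.

End dyadic_average.

(** * The fountain *)

Section fountain.
Context (R : realType).

Definition sparse_open : set Nstar := \bigcup_(A in sparse R) Astar A.

Lemma open_sparse_open : open sparse_open.
Proof. by apply: bigcup_open => A _; exact: open_Astar. Qed.

(** The sparse sets form an ideal, so compactness reduces a clopen subset of
    the union to a single member of the union. *)
Lemma sparse_of_Astar_sub (A : set nat) : Astar A `<=` sparse_open -> sparse R A.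
Proof.
move=> AU; have cptA : compact (Astar A).
  by apply: subclosed_compact compact_Nstar _ => //; case: (clopen_Astar A).
move: cptA; rewrite compact_cover => /(_ _ (sparse R) (@Astar)).
case=> // [B _|D Dsp AD]; first exact: open_Astar.
pose B := \big[setU/set0]_(C <- finmap.enum_fset D) C.
have spB : sparse R B.
  rewrite /B big_seq; elim/big_ind : _ => [|C1 C2 sC1 sC2|C /Dsp/set_mem//].
    exact/finite_sparse/finite_set0.
  exact: (sparse_subU (C := C1) (D := C2)).
have AB : Astar A `<=` Astar B.
  move=> y /AD[C /= CD yC]; have : C `<=` B.
    by rewrite /B -bigcup_seq; exact: bigcup_sup.
  by move: yC; rewrite !AstarE /= => yC CB; exact: filterS yC.
apply: (sparse_subU (C := B) (D := A `\` B)) => //.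
  by move=> n An; have [Bn|nBn] := pselect (B n); [left | right].
by apply: finite_sparse; apply/sub_Astar.
Qed.

(** A clopen set that avoids all sparse sets would be some [A^*] with [A]
    infinite, but [A] has an infinite sparse subset. *)
Lemma nowhere_dense_fountain : nowhere_dense (~` sparse_open).
Proof.
rewrite /nowhere_dense -(closure_id _).1; last first.
  by apply: open_closedC; exact: open_sparse_open.
apply/seteqP; split=> // y /nbhs_Astar[A [yA AF]].
have infA : infinite_set A by move=> /Astar0P A0; rewrite A0 in yA.
have [C [CA infC spC]] := infinite_sparse_subset R infA.
have [z zC] := infinite_Astar infC.
apply: (AF z); last by exists C.
by move: zC; rewrite !AstarE; exact: filterS.
Qed.

(** The point [y] is arbitrary: the fountain is the whole remainder. *)
Lemma avgq_fountain : ~ fountainless (@avgq R).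
Proof.
move=> /(_ _ nowhere_dense_fountain); rewrite /nowhere_dense.
set Y := [set y | _]; suff -> : Y = setT.
  rewrite closureT interiorT => /seteqP[/(_ point)] + _; exact.
apply/seteqP; split=> // y _.
pose phi := adjoint (@avgq R) (delta y).
have lphi : scalar phi.
  by move=> a p q; rewrite /phi /adjoint /delta /= linearP star_scalar.
have phiE f : phi (cls f) = beta_ext (avg f) (Nstar_val y).
  by rewrite /phi /adjoint /delta /= avgq_cls star_cls.
have phi_ge0 (f : linf R nat) : (forall n, 0 <= f n) -> 0 <= phi (cls f).
  move=> f0; rewrite phiE; apply: beta_ext_ge0 => n.
  by rewrite -(avg_fun_cst 0 n); apply: le_avg_fun.
have phi1 : phi (cls (indic_linf R setT)) = 1.
  rewrite phiE; apply: beta_ext_eq.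
  have -> : (avg (indic_linf R setT) : nat -> R) = cst 1.
    by apply/funext => n; rewrite /= indicT avg_fun_cst.
  exact: cvg_cst.
have [mu [mu_phi muU]] := riesz_Nstar lphi phi_ge0.
exists (charge_of_finite_measure mu); split=> //.
  exists setT => //; apply/eqP; rewrite gt_eqF//.
  apply: (@lt_le_trans _ _ 1%E); first by rewrite lte_fin.
  rewrite [leRHS](muU _ openT); apply: ereal_sup_ubound.
  by exists setT => //; rewrite phi1.
have mU : measurable (sparse_open : set borelNstar).
  by apply: sub_sigma_algebra; exact: open_sparse_open.
exists sparse_open; split=> //; last by rewrite setCK.
rewrite charge_variation_measure// [LHS](muU _ open_sparse_open).
apply/eqP; rewrite eq_le; apply/andP; split.
  apply: ge_ereal_sup => _ [A /sparse_of_Astar_sub spA <-].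
  rewrite /phi /adjoint /delta /= avgq_sparse// -cls0 star_cls.
  by rewrite (@beta_ext_eq _ _ _ 0)//; exact: cvg_cst.
apply: ereal_sup_ubound; exists set0; first by move=> z; rewrite (Astar0P _).2.
rewrite /phi /adjoint /delta /= avgq_sparse; last exact/finite_sparse/finite_set0.
by rewrite -cls0 star_cls (@beta_ext_eq _ _ _ 0)//; exact: cvg_cst.
Qed.

End fountain.

(** * No copies of quotient maps *)

Section no_canonical_part.
Context (R : realType).

Lemma I_indic (A C : set nat) : C `<=` A ->
  I_ A (cls (indic_linf R ((set_val : A -> nat) @^-1` C))) = cls (indic_linf R C).
Proof.
move=> CA; rewrite /I_ ext0q_cls ext0_indic; last exact: val_inj.
congr (cls (indic_linf R _)); apply/seteqP; split=> [_ [a Ca <-]//|n Cn].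
by exists (exist _ n (mem_set (CA _ Cn))).
Qed.

(** The images of [psi] cover the nonempty [C^*] for a sparse [C], where the
    indicator of [C] is 1 although the operator sends it to 0. *)
Lemma avgq_not_canonizable (A : set nat) (psi : Nstar -> Astar A) :
  infinite_set A -> ~ canonizable_along (@avgq R \o I_ A) psi.
Proof.
move=> infA [_ surj [r r0 can]].
have [C [CA infC spC]] := infinite_sparse_subset R infA.
have [z zC] := infinite_Astar infC.
have zA : Astar A z by move: zC; rewrite !AstarE; exact: filterS.
have [y _ psiy] : range psi (exist _ z (mem_set zA)) by rewrite surj.
have := can (cls (indic_linf R ((set_val : A -> nat) @^-1` C))) y.
rewrite /starA /= (I_indic CA) psiy star_indic indicE mem_set// mulr1.
rewrite avgq_sparse// -cls0 star_cls (@beta_ext_eq _ _ _ 0); last exact: cvg_cst.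
by move=> /esym/eqP; exact/negP.
Qed.

(** A trivial part would send the indicator of an infinite sparse set to [r]
    times the indicator of an infinite set. *)
Lemma avgq_nowhere_trivial : nowhere_trivial (@avgq R).
Proof.
move=> A B infA infB [A' [B' [cA [cB [sigma [r [bij_sigma r0 triv]]]]]]].
have infA' : infinite_set A'.
  move=> finA'; apply: infA; have : finite_set (A' `|` (A `\` A')).
    by rewrite finite_setU; split=> //; exact: cA.2.
  by apply: sub_finite_set => n An; have [] := pselect (A' n); [left|right].
have [C [CA' infC spC]] := infinite_sparse_subset R infA'.
pose D : set A' := (set_val : A' -> nat) @^-1` C.
have := triv (indic_linf R D).
have -> : T_BA (@avgq R) B (iota_ cA.1 (cls (indic_linf R D))) = 0.
  have DE : subfun cA.1 @` D = (set_val : A -> nat) @^-1` C.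
    apply/seteqP; split=> [_ [a Ca <-]//|a Ca].
    exists (exist _ (set_val a) (mem_set (CA' _ Ca))) => //.
    exact/val_inj.
  rewrite /T_BA /iota_ /= ext0q_cls ext0_indic; last exact: subfun_inj.
  rewrite DE I_indic; last by move=> n /CA' /cA.1.
  by rewrite avgq_sparse// /P_ resq0//; exact: val_inj.
rewrite /iota_ ext0q_cls => /esym/cls_eq0/c0P/(_ `|r|).
rewrite normr_gt0 => /(_ r0) fin_r; apply: infC.
have finD : finite_set (sigma @^-1` D).
  have inj_e : injective (subfun cB.1) by exact: subfun_inj.
  have := finite_preimage (f := subfun cB.1) (fun x y _ _ => @inj_e x y) fin_r.
  apply: sub_finite_set => b Db /=.
  by rewrite ext0_funE; [rewrite /= !fctE indicE mem_set// /GRing.scale /= mulr1|].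
have finC := finite_image set_val (finite_image sigma finD).
apply: sub_finite_set finC => n Cn.
have [tau _ tauK] := bij_sigma.
pose a : A' := exist _ n (mem_set (CA' _ Cn)).
by exists a => //; exists (tau a); rewrite /= ?tauK.
Qed.

End no_canonical_part.

Theorem corollary4p6 (R : realType) :
  exists T : {linear linf_c0 R nat -> linf_c0 R nat},
    [/\ bounded_operator T,
        matrix_operator T,
        ~ fountainless T,
        (forall A : set nat, infinite_set A ->
          T \o I_ A <> (fun=> 0) ->
          forall psi : Nstar -> Astar A, ~ canonizable_along (T \o I_ A) psi)
      & nowhere_trivial T].
Proof.
exists (@avgq R); split.
- exact: avgq_bounded.
- exact: avgq_matrix.
- exact: avgq_fountain.
- by move=> A infA _ psi; exact: avgq_not_canonizable.
- exact: avgq_nowhere_trivial.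
Qed.
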